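(* Let $R$ be a ring and $I$ a regular ideal of $R$. Then the following are equivalent: (1) $R$ is left endo-Noetherian; (2) $R\times R$ is left endo-Noetherian; (3) $R\bowtie I$ is left endo-Noetherian.
   Context: All rings are associative with identity, not necessarily commutative; ideals are two-sided. An ideal is called regular if it contains a regular element (an element that is neither a left nor a right zero divisor). The amalgamated duplication of $R$ along $I$ is the subring $R\bowtie I=\{(r,r+i): r\in R,\ i\in I\}$ of $R\times R$. For a ring $A$ and $a\in A$, $\ell.\mathrm{ann}_A(a)=\{b\in A: ba=0\}$. A ring $A$ is called left endo-Noetherian if for every sequence $(a_i)_{i\in\mathbb N}$ of elements of $A$ with $\ell.\mathrm{ann}_A(a_1)\subseteq \ell.\mathrm{ann}_A(a_2)\subseteq\cdots$, there is a positive integer $n$ with $\ell.\mathrm{ann}_A(a_k)=\ell.\mathrm{ann}_A(a_n)$ for all $k\ge n$. *)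

(* Defs.v *)
From HB Require Import structures.
From mathcomp Require Import all_boot all_algebra.
From mathcomp Require Import boolp classical_sets.

Set Implicit Arguments.
Unset Strict Implicit.
Unset Printing Implicit Defensive.

Import GRing.Theory.
Local Open Scope classical_set_scope.
Local Open Scope ring_scope.

(* Ideals need not be proper here (unlike [proper_ideal] in ring_quotient.v,
   which is moreover one-sided). *)
Record ideal (R : pzRingType) := Ideal {
  ideal_set : set R;
  ideal0 : ideal_set 0;
  idealB : forall x y, ideal_set x -> ideal_set y -> ideal_set (x - y);
  idealMl : forall r x, ideal_set x -> ideal_set (r * x);
  idealMr : forall r x, ideal_set x -> ideal_set (x * r)
}.

Definition left_zero_divisor (R : pzRingType) (a : R) : Prop :=
  exists b : R, b <> 0 /\ a * b = 0.

Definition right_zero_divisor (R : pzRingType) (a : R) : Prop :=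
  exists b : R, b <> 0 /\ b * a = 0.

Definition regular_element (R : pzRingType) (a : R) : Prop :=
  ~ left_zero_divisor a /\ ~ right_zero_divisor a.

Definition regular_ideal (R : pzRingType) (I : ideal R) : Prop :=
  exists s : R, ideal_set I s /\ regular_element s.

Definition lann (A : pzRingType) (a : A) : set A := [set b | b * a = 0].

Definition left_endo_noetherian (A : pzRingType) : Prop :=
  forall a : nat -> A,
    (forall i : nat, lann (a i) `<=` lann (a i.+1)) ->
    exists n : nat, forall k : nat, (n <= k)%N -> lann (a k) = lann (a n).

Definition duplication_set (R : pzRingType) (I : ideal R) : set (R * R) :=
  [set x | exists r i : R, ideal_set I i /\ x = (r, r + i)].

Definition duplication_pred (R : pzRingType) (I : ideal R) : {pred R * R} :=
  [pred x | x \in duplication_set I].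

Lemma duplication_subring_closed (R : pzRingType) (I : ideal R) :
  subring_closed (duplication_pred I).
Proof.
split=> [|x y|x y]; rewrite !inE.
- by exists 1, 0; split; [exact: ideal0 | rewrite addr0].
- move=> [r [i [Ii ->]]] [s [j [Ij ->]]]; exists (r - s), (i - j).
  by split; [exact: idealB | congr pair; rewrite /= opprD addrACA].
- move=> [r [i [Ii ->]]] [s [j [Ij ->]]].
  exists (r * s), (r * j + i * (s + j)); split.
    rewrite -[i * _]opprK; apply: idealB; first exact: idealMl.
    by rewrite -sub0r; apply: idealB; [exact: ideal0 | exact: idealMr].
  by congr pair; rewrite /= mulrDl mulrDr addrA.
Qed.

Definition duplication (R : pzRingType) (I : ideal R) : Type :=
  {x : R * R | duplication_pred I x}.

HB.instance Definition _ (R : pzRingType) (I : ideal R) :=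
  SubChoice.on (duplication I).
HB.instance Definition _ (R : pzRingType) (I : ideal R) :=
  GRing.SubChoice_isSubPzRing.Build (R * R)%type (duplication_pred I)
    (duplication I) (duplication_subring_closed I).

(* Main.v *)
(* Annihilators in [R * R] are products of annihilators in [R], so chains
   stabilise componentwise, and [R] embeds diagonally in the duplication.
   If [s \in I] is regular and [(b, c)] kills [(x, y)], then [(s b, 0)] and
   [(0, s c)] lie in the duplication and kill [(x, y)]; cancelling [s] shows that
   inclusions of annihilators in the duplication lift to [R * R]. *)
Require Import Defs.
From mathcomp Require Import all_boot all_algebra.
From mathcomp Require Import boolp classical_sets.

Import GRing.Theory.
Local Open Scope classical_set_scope.
Local Open Scope ring_scope.

Lemma regular_mul_eq0 (R : pzRingType) (s b : R) :
  regular_element s -> s * b = 0 -> b = 0.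
Proof. by move=> [nz _] sb0; apply: contrapT => b_neq0; apply: nz; exists b. Qed.

Lemma lann_pair (R S : pzRingType) (x : R * S) :
  lann x = lann x.1 `*` lann x.2.
Proof.
by apply/seteqP; split=> -[b c] /=; [case | case=> ? ?; congr pair].
Qed.

Lemma left_endo_noetherian_prod (R S : pzRingType) :
  left_endo_noetherian R -> left_endo_noetherian S ->
  left_endo_noetherian (R * S)%type.
Proof.
move=> noethR noethS a chain.
have [|m stab1] := noethR (fun i => (a i).1).
  (* Padding with 0, which annihilates everything, tests the chain on one coordinate at a time. *)
  move=> i b b0; have := chain i (b, 0).
  by rewrite !lann_pair => -[|//]; split=> //; exact: mul0r.
have [|n stab2] := noethS (fun i => (a i).2).
  move=> i c c0; have := chain i (0, c).
  by rewrite !lann_pair => -[|//]; split=> //; exact: mul0r.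
exists (maxn m n) => k; rewrite geq_max => /andP[le_mk le_nk].
by rewrite !lann_pair !(stab1, stab2) ?leq_maxl ?leq_maxr.
Qed.

Section Duplication.
Variables (R : pzRingType) (I : ideal R).

Lemma mem_duplication (x y : R) :
  ideal_set I (y - x) -> duplication_pred I (x, y).
Proof.
by move=> Iyx; rewrite /= inE; exists x, (y - x); rewrite [x + _]addrC subrK.
Qed.

Definition dup (x y : R) (h : ideal_set I (y - x)) : duplication I :=
  Sub (x, y) (mem_duplication x y h).

(** Reduces annihilators in the duplication to coordinatewise ones, through [lann_pair]. *)
Lemma lann_val (u v : duplication I) : lann u v <-> lann (val u) (val v).
Proof.
split=> [vu0|vu0].
  have valM : val (v * u) = val v * val u by exact: rmorphM.
  by rewrite /lann /mkset -valM vu0.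
by apply: val_inj; exact: vu0.
Qed.

Lemma lann_val_sub (u v : duplication I) :
  regular_ideal I -> lann u `<=` lann v -> lann (val u) `<=` lann (val v).
Proof.
move=> [s [Is sreg]] uv [b c]; rewrite !lann_pair /= => -[bu0 cu0].
(* The pair [(b, c)] itself may lie outside the duplication, so [uv] is applied to [(s * b, 0)] and
   [(0, s * c)], whose coordinates differ by elements of [I]. Putting [s] on the left keeps them
   annihilators of [val u]. *)
have Isb : ideal_set I (0 - s * b).
  by apply: idealB; [exact: ideal0 | exact: Defs.idealMr].
have Isc : ideal_set I (s * c - 0) by rewrite subr0; exact: Defs.idealMr.
have /uv/lann_val : lann u (dup (s * b) 0 Isb).
  apply/lann_val; rewrite lann_pair SubK; split; rewrite /lann /= ?mul0r//.
  by rewrite -mulrA bu0 mulr0.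
rewrite lann_pair SubK /lann /= -mulrA => -[/(regular_mul_eq0 _ _ _ sreg) bv0 _].
have /uv/lann_val : lann u (dup 0 (s * c) Isc).
  apply/lann_val; rewrite lann_pair SubK; split; rewrite /lann /= ?mul0r//.
  by rewrite -mulrA cu0 mulr0.
by rewrite lann_pair SubK /lann /= -mulrA => -[_ /(regular_mul_eq0 _ _ _ sreg)].
Qed.

Lemma left_endo_noetherian_duplication : regular_ideal I ->
  left_endo_noetherian (R * R)%type -> left_endo_noetherian (duplication I).
Proof.
move=> regI noeth a chain.
have [|n stab] := noeth (fun i => val (a i)).
  by move=> i; exact: lann_val_sub.
exists n => k le_nk; apply/seteqP.
by split=> v /lann_val vk0; apply/lann_val; move: vk0; rewrite (stab _ le_nk).
Qed.

Lemma left_endo_noetherian_of_duplication :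
  left_endo_noetherian (duplication I) -> left_endo_noetherian R.
Proof.
have Idiag x : ideal_set I (x - x) by rewrite subrr; exact: ideal0.
pose diag x := dup x x (Idiag x).
have diagE x b : lann (diag x) (diag b) <-> lann x b.
  by rewrite lann_val !SubK lann_pair; split=> [[]|].
move=> noeth a chain.
have [|n stab] := noeth (fun i => diag (a i)).
  (* An annihilator [v] of a diagonal element need not be diagonal, but each of its coordinates
     annihilates [a i]. *)
  move=> i v /lann_val; rewrite lann_pair => -[v1 v2].
  by apply/lann_val; rewrite lann_pair; split; exact: chain.
exists n => k le_nk; apply/seteqP.
(* Testing the stable annihilators on diagonal elements recovers those in [R]. *)
by split=> b /diagE bk0; apply/diagE; move: bk0; rewrite (stab _ le_nk).
Qed.

End Duplication.

Theorem theorem6 (R : pzRingType) (I : ideal R) (hI : regular_ideal I) :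
  [<-> left_endo_noetherian R;
       left_endo_noetherian (R * R)%type;
       left_endo_noetherian (duplication I)].
Proof.
tfae.
- by move=> noeth; exact: left_endo_noetherian_prod.
- exact: left_endo_noetherian_duplication.
- exact: left_endo_noetherian_of_duplication.
Qed.
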